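(* As $x\to\infty$, $$\sum_{r\le x}N_3(1,r)=\frac{36\,G}{\pi^4}\,x^3+O(x^2\log x).$$
   Context: For $r\in\mathbb{N}=\{1,2,\ldots\}$, $N_3(1,r)$ is the number of solutions $(x,y,z)\in(\mathbb{Z}/r\mathbb{Z})^3$ of $x^2+y^2+z^2\equiv 1\pmod r$. The sum runs over all positive integers $r\le x$. $G=\sum_{n=0}^{\infty}\frac{(-1)^n}{(2n+1)^2}$ is the Catalan constant. *)

(* Defs.v *)
From HB Require Import structures.
From mathcomp Require Import all_boot all_order all_algebra.
From mathcomp Require Import all_classical all_reals all_analysis.
Set Implicit Arguments.
Unset Strict Implicit.
Unset Printing Implicit Defensive.
Import Order.TTheory GRing.Theory Num.Theory.
Import numFieldNormedType.Exports.
Local Open Scope ring_scope.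

(* Makes [f = g +O_ +oo h] available for functions of a real variable. *)
Canonical pinfty_nbhs_filter_on (R : numFieldType) :=
  FilterType (pinfty_nbhs R) _.

(* Residues mod [r] are represented by ['I_r] and congruences taken in [nat],
   since ['Z_r] is the ring of integers mod 2 when [r = 1]. *)
Definition N3 (n r : nat) : nat :=
  #|[set v : 'I_r * 'I_r * 'I_r |
      (v.1.1 ^ 2 + v.1.2 ^ 2 + v.2 ^ 2 == n %[mod r])%N]|.

Definition catalan (R : realType) : R :=
  limn (series (fun n : nat => (-1) ^+ n / (2 * n + 1)%:R ^+ 2 : R)).

(* Main.v *)
(* With [chi] the nontrivial character mod 4, [N3 1 r] is [r ^ 2] times
   [\sum_(d | r) mu(d)^2 chi(d) / d], times 3/2 when [4 | r]: solutions lift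
   uniformly modulo [p r] when [p] already divides [r] (when 8 does, if [p = 2];
   scale by square roots of [1 + r t]), the Chinese remainder theorem reduces
   to prime [r], and stereographic projection counts the points of the sphere
   over F_p.

   Summing over [r = d m] gives [(3 / 8) D x ^ 3] up to [O(x ^ 2 log x)], where
   [D = \sum_d mu(d)^2 chi(d) / d ^ 2]. Since each [n] is uniquely [d e ^ 2]
   with [d] squarefree, [D * \sum_(e odd) e ^ -4 = \sum_n chi(n) / n ^ 2 = G].
   Finally [\sum_(e odd) e ^ -4 = pi ^ 4 / 96] because the sums of
   [1 / sin ^ 2] and [1 / sin ^ 4] over the angles [(2 k + 1) pi / 2 ^ (n + 2)]
   obey a linear recursion under halving, while [1 / sin ^ 2 - 1 <= 1 / x ^ 2
   <= 1 / sin ^ 2]. *)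
Require Import Defs.
From HB Require Import structures.
From mathcomp Require Import all_boot all_order all_algebra.
From mathcomp Require Import all_classical all_reals all_analysis.
From mathcomp Require Import finfield.
From mathcomp Require Import zify ring lra.
Import Order.TTheory GRing.Theory Num.Theory.
Import numFieldNormedType.Exports.

(** * Lifting solutions and the Chinese remainder theorem *)

Local Open Scope nat_scope.

Lemma N3E n r : N3 n r =
  \sum_(i < r) \sum_(j < r) \sum_(k < r)
    (i ^ 2 + j ^ 2 + k ^ 2 == n %[mod r]).
Proof.
rewrite /N3 -sum1dep_card big_mkcond /= pair_bigA /= pair_bigA /=.
apply: eq_bigr => -[[i j] k] _ /=.
by case: eqP.
Qed.

Lemma sum_ord_periodic (p r : nat) (F : nat -> nat) :
  (forall i, F (i %% r) = F i) ->
  \sum_(i < p * r) F i = p * \sum_(i < r) F i.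
Proof.
move=> FE; elim: p => [|p IHp]; first by rewrite !mul0n big_ord0.
rewrite mulSn addnC big_split_ord /= IHp mulSn addnC; congr (_ + _).
by apply: eq_bigr => i _; rewrite -[LHS]FE modnMDl FE.
Qed.

Lemma eq_sq_modl a b r n : ((a %% r) ^ 2 + b == n %[mod r]) = (a ^ 2 + b == n %[mod r]).
Proof. by rewrite -modnDml modnXm modnDml. Qed.

Lemma eqn_mod_coprime_mul2l u a b r : coprime u r ->
  (u * a == u * b %[mod r]) = (a == b %[mod r]).
Proof.
move=> cop; wlog ab : a b / a <= b => [hw|].
  by have [/hw //|/ltnW/hw] := leqP a b; rewrite eq_sym => ->; rewrite eq_sym.
rewrite [LHS]eq_sym [RHS]eq_sym !eqn_mod_dvd ?leq_mul //.
by rewrite -mulnBr Gauss_dvdr // coprime_sym.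
Qed.

(** The classes [n + r * t] with [t < p] are the distinct lifts modulo [p * r] of the class of [n]
    modulo [r], so [m] lies in exactly one of them or in none. *)
Lemma sum_eqmod_lifts m n p r : 0 < p -> 0 < r ->
  \sum_(t < p) (m == n + r * t %[mod p * r]) = (m == n %[mod r]).
Proof.
move=> p0 r0.
have [mn|mn] := boolP (_ == _ %[mod r]); last first.
  rewrite big1 // => t _; case: eqP => // /(congr1 (modn^~ r)).
  rewrite !modn_dvdm ?dvdn_mull // => h.
  by move: mn; rewrite h mulnC addnC modnMDl eqxx.
(* Adding the multiple [n * (p * r)] keeps the class of [m] and prevents the subtraction of [n] in
   [nat] from truncating. *)
have nm : n <= m + n * (p * r).
  by rewrite (leq_trans _ (leq_addl _ _)) // leq_pmulr // muln_gt0 p0.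
have /dvdnP[q qE] : r %| m + n * (p * r) - n.
  by rewrite -eqn_mod_dvd // mulnA addnC modnMDl.
have mE : m = n + r * q %[mod p * r].
  by rewrite [r * q]mulnC -qE subnKC // addnC modnMDl.
have tp : q %% p < p by rewrite ltn_pmod.
rewrite (bigD1 (Ordinal tp)) //= big1 => [|t tq].
  rewrite addn0 mE; apply/eqP; rewrite eqb1; apply/eqP.
  by rewrite -[LHS]modnDmr -[RHS]modnDmr ![r * _]mulnC -!muln_modl modn_mod.
rewrite mE eqn_modDl ![r * _]mulnC -!muln_modl eqn_pmul2r //.
case: eqP => // e; case/eqP: tq; apply: val_inj => /=.
by rewrite e modn_small.
Qed.

(** Every triple modulo [p * r] above a solution modulo [r] solves exactly one of the lifted
    congruences, and each triple modulo [r] has [p ^ 3] triples above it. *)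
Lemma sum_N3_lifts n p r : 0 < p -> 0 < r ->
  \sum_(t < p) N3 (n + r * t) (p * r) = p ^ 3 * N3 n r.
Proof.
move=> p0 r0; under eq_bigr do rewrite N3E.
rewrite exchange_big /=.
under eq_bigr do rewrite exchange_big /=.
under eq_bigr do under eq_bigr do rewrite exchange_big /=.
under eq_bigr do under eq_bigr do under eq_bigr do rewrite sum_eqmod_lifts //.
transitivity (\sum_(i < p * r) \sum_(j < p * r) p * \sum_(k < r) (i ^ 2 + j ^ 2 + k ^ 2 == n %[mod r])).
  apply: eq_bigr => i _; apply: eq_bigr => j _.
  rewrite (sum_ord_periodic p r (fun k => i ^ 2 + j ^ 2 + k ^ 2 == n %[mod r] : nat)) // => k.
  by rewrite addnC eq_sq_modl addnC.
transitivity (\sum_(i < p * r) p * \sum_(j < r) p * \sum_(k < r) (i ^ 2 + j ^ 2 + k ^ 2 == n %[mod r])).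
  apply: eq_bigr => i _.
  rewrite (sum_ord_periodic p r (fun j => p * \sum_(k < r) (i ^ 2 + j ^ 2 + k ^ 2 == n %[mod r]))) // => j.
  congr (_ * _); apply: eq_bigr => k _.
  by rewrite -addnA addnCA eq_sq_modl addnCA addnA.
rewrite (sum_ord_periodic p r (fun i => p * \sum_(j < r) p * \sum_(k < r) (i ^ 2 + j ^ 2 + k ^ 2 == n %[mod r]))).
  rewrite N3E; under eq_bigr do rewrite -big_distrr /=.
  by rewrite -!big_distrr !expnS expn0 muln1 /= !mulnA.
move=> i; congr (_ * _); apply: eq_bigr => j _; congr (_ * _); apply: eq_bigr => k _.
by rewrite -!addnA eq_sq_modl.
Qed.

(* Scaling by a unit [u] multiplies the quadratic form by [u ^ 2]. *)
Lemma N3_mul_sq u n r : coprime u r -> N3 (u ^ 2 * n) r = N3 n r.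
Proof.
case: r => [|r] cop; first by rewrite !N3E !big_ord0.
rewrite !N3E.
pose f (i : 'I_r.+1) : 'I_r.+1 := inord ((u * i) %% r.+1).
have fE i : f i = (u * i) %% r.+1 :> nat by rewrite inordK // ltn_pmod.
have finj : injective f.
  move=> i j /(congr1 val); rewrite /= !fE => /eqP.
  rewrite eqn_mod_coprime_mul2l // !modn_small // => /eqP ij.
  exact: val_inj.
rewrite (reindex_inj finj); apply: eq_bigr => i _.
rewrite (reindex_inj finj); apply: eq_bigr => j _.
rewrite (reindex_inj finj); apply: eq_bigr => k _.
rewrite !fE -[in LHS]addnA eq_sq_modl addnCA eq_sq_modl addnCA addnA addnC.
rewrite eq_sq_modl addnC !expnMn -!mulnDr eqn_mod_coprime_mul2l //.
exact: coprimeXl.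
Qed.

(* When all the classes [1 + r t] lifting [1] are squares of units modulo [p r],
   scaling shows that they have equally many solutions. *)
Lemma N3_lift p r : 0 < p -> 0 < r ->
  (forall t, t < p -> exists u, coprime u (p * r) /\ u ^ 2 = 1 + r * t %[mod p * r]) ->
  N3 1 (p * r) = p ^ 2 * N3 1 r.
Proof.
move=> p0 r0 ex_u; apply/eqP; rewrite -(eqn_pmul2l p0) mulnA -expnS.
rewrite -sum_N3_lifts //; apply/eqP.
have N3mod a b : a = b %[mod p * r] -> N3 a (p * r) = N3 b (p * r).
  by move=> ab; rewrite /N3 ab.
under eq_bigr => t _.
  have [u [cop /N3mod <-]] := ex_u t (ltn_ord t).
  rewrite -[u ^ 2]muln1 N3_mul_sq //; over.
by rewrite sum_nat_const card_ord.
Qed.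

Lemma N3_lift_odd p r : prime p -> odd p -> 0 < r -> p %| r ->
  N3 1 (p * r) = p ^ 2 * N3 1 r.
Proof.
move=> pp op r0 pr; apply: N3_lift => // [|t tp]; first exact: prime_gt0.
(* [p.+1./2] inverts 2 modulo [p], so the cross term of the square is [r * t] modulo [p * r]; the
   last term contains [r ^ 2], a multiple of [p * r] because [p] divides [r]. *)
exists (1 + r * (t * p.+1./2)); split.
  have cr : coprime (1 + r * (t * p.+1./2)) r by rewrite coprime_sym /coprime addnC [_ * (t * _)]mulnC gcdnMDl gcdn1.
  rewrite coprimeMr cr andbT; exact: coprime_dvdr pr cr.
have [q ->] := dvdnP pr.
have pE : 2 * p.+1./2 = p.+1 by rewrite mul2n -[RHS]odd_double_half /= op.
have -> : (1 + q * p * (t * p.+1./2)) ^ 2 =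
   (t + q * (t * p.+1./2) * (t * p.+1./2)) * (p * (q * p)) + (1 + q * p * t).
  have -> : (1 + q * p * (t * p.+1./2)) ^ 2 =
     1 + q * p * t * (2 * p.+1./2) + q * (t * p.+1./2) * (t * p.+1./2) * (p * (q * p)) by ring.
  by rewrite pE mulnS; ring.
by rewrite modnMDl.
Qed.

(** The root is [1 + (r / 2) * t]: the last term of its square contains [r ^ 2 / 4], which is a
    multiple of [2 * r] when 8 divides [r]. *)
Lemma N3_lift_2 r : 0 < r -> 8 %| r -> N3 1 (2 * r) = 2 ^ 2 * N3 1 r.
Proof.
move=> r0 /dvdnP[q rE]; apply: N3_lift => // t t2.
exists (1 + r./2 * t).
have rE2 : r./2 = q * 4 by rewrite rE -[8]/(2 * 4) mulnA [q * 2]mulnC -mulnA mul2n doubleK.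
split.
  have cr : coprime (1 + r./2 * t) (r./2) by rewrite coprime_sym /coprime addnC [_ * t]mulnC gcdnMDl gcdn1.
  have c2 : coprime (1 + r./2 * t) 2.
    by apply: coprime_dvdr cr; rewrite rE2 -[4]/(2 * 2) mulnA dvdn_mull.
  have -> : 2 * r = 2 * 2 * r./2 by rewrite rE2 rE; ring.
  by rewrite !coprimeMr cr c2.
have -> : (1 + r./2 * t) ^ 2 = (q * t ^ 2) * (2 * r) + (1 + r * t).
  by rewrite rE2 rE; ring.
by rewrite modnMDl.
Qed.

Lemma sum_ord_crt r s (F : nat -> nat -> nat) : coprime r s ->
  \sum_(i < r * s) F (i %% r) (i %% s) = \sum_(a < r) \sum_(b < s) F a b.
Proof.
have [->|r0] := posnP r; first by rewrite mul0n !big_ord0.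
have [->|s0] := posnP s.
  by rewrite muln0 big_ord0 big1 // => i _; rewrite big_ord0.
move=> cop; rewrite pair_bigA /=.
have h (p : 'I_r * 'I_s) : chinese r s p.1 p.2 %% (r * s) < r * s.
  by rewrite ltn_pmod // muln_gt0 r0.
rewrite (reindex (fun p : 'I_r * 'I_s => Ordinal (h p))) /=; last first.
  exists (fun i : 'I_(r * s) => (Ordinal (ltn_pmod i r0), Ordinal (ltn_pmod i s0))).
    move=> [a b] _; congr (_, _); apply: val_inj => /=.
      by rewrite modn_dvdm ?dvdn_mulr // chinese_modl // modn_small.
    by rewrite modn_dvdm ?dvdn_mull // chinese_modr // modn_small.
  move=> i _; apply: val_inj => /=.
  by rewrite -chinese_mod // modn_small.
apply: eq_bigr => -[a b] _ /=.
rewrite modn_dvdm ?dvdn_mulr // chinese_modl // modn_dvdm ?dvdn_mull //.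
by rewrite chinese_modr // !modn_small.
Qed.

(** A congruence modulo [r * s] is the conjunction of those modulo [r] and [s], hence its indicator
    is a product; each coordinate is then split into its two residues. *)
Lemma N3_coprime n r s : coprime r s -> N3 n (r * s) = N3 n r * N3 n s.
Proof.
move=> cop.
pose Q m a b c : nat := a ^ 2 + b ^ 2 + c ^ 2 == n %[mod m].
have Qm m a b c : Q m (a %% m) (b %% m) (c %% m) = Q m a b c.
  rewrite /Q; congr nat_of_bool.
  by rewrite -[in LHS]addnA eq_sq_modl addnCA eq_sq_modl addnCA addnA addnC eq_sq_modl addnC.
transitivity (\sum_(i < r * s) \sum_(j < r * s) \sum_(k < r * s)
    Q r (i %% r) (j %% r) (k %% r) * Q s (i %% s) (j %% s) (k %% s)).
  rewrite N3E; do 3![apply: eq_bigr => ? _].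
  by rewrite !Qm /Q chinese_remainder // mulnb.
under eq_bigr => i _.
  under eq_bigr => j _.
    rewrite (sum_ord_crt r s (fun k k' => Q r (i %% r) (j %% r) k * Q s (i %% s) (j %% s) k')) //.
  over.
  rewrite (sum_ord_crt r s (fun j j' => \sum_(k < r) \sum_(k' < s) Q r (i %% r) j k * Q s (i %% s) j' k')) //.
over.
rewrite (sum_ord_crt r s (fun i i' => \sum_(j < r) \sum_(j' < s) \sum_(k < r) \sum_(k' < s) Q r i j k * Q s i' j' k')) //.
rewrite !N3E; do 3![rewrite big_distrlr /=; do 2![apply: eq_bigr => ? _]].
by [].
Qed.

(** Sums over lists of natural numbers evaluate under [vm_compute], which settles the moduli 1, 2, 4
    and 8. *)
Lemma N3_sumn n r : let I := iota 0 r in N3 n r =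
  sumn [seq sumn [seq sumn [seq nat_of_bool (i ^ 2 + j ^ 2 + k ^ 2 == n %[mod r])
    | k <- I] | j <- I] | i <- I].
Proof.
have sumE (F : nat -> nat) : \sum_(i < r) F i = sumn [seq F i | i <- iota 0 r].
  by rewrite sumnE big_map -[r in iota _ r]subn0 big_mkord.
rewrite N3E; pose Q i j k : nat := i ^ 2 + j ^ 2 + k ^ 2 == n %[mod r].
rewrite (sumE (fun i => \sum_(j < r) \sum_(k < r) Q i j k)).
congr sumn; apply: eq_map => i; rewrite (sumE (fun j => \sum_(k < r) Q i j k)).
by congr sumn; apply: eq_map => j; rewrite (sumE (Q i j)).
Qed.

Lemma N3_1 : N3 1 1 = 1.
Proof. by rewrite N3_sumn; vm_compute. Qed.

Lemma N3_2 : N3 1 2 = 4.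
Proof. by rewrite N3_sumn; vm_compute. Qed.

Lemma N3_4 : N3 1 4 = 24.
Proof. by rewrite N3_sumn; vm_compute. Qed.

Lemma N3_8 : N3 1 8 = 96.
Proof. by rewrite N3_sumn; vm_compute. Qed.

(** * Circles and spheres over finite fields *)

Local Open Scope ring_scope.

Definition circle_card {F : finFieldType} (c : F) : nat :=
  (\sum_(s : F) \sum_(t : F) (s ^+ 2 + t ^+ 2 == c)%R)%N.

Definition sphere_card {F : finFieldType} (c : F) : nat :=
  (\sum_(x : F) \sum_(y : F) \sum_(z : F) (x ^+ 2 + y ^+ 2 + z ^+ 2 == c)%R)%N.

Lemma sum_eq1 (T : finType) (P : pred T) (x0 : T) :
  (forall x, P x = (x == x0)) -> (\sum_x (P x : nat) = 1)%N.
Proof.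
move=> PE; rewrite (bigD1 x0) //= PE eqxx big1 // => x xx0.
by rewrite PE (negPf xx0).
Qed.

(** The only candidate is [x = 1 - 2 / w], which differs from 1 because 2 is nonzero. *)
Lemma sum_line_param (F : finFieldType) (w : F) : (2 : F) != 0 ->
  (\sum_(x : F | (x != 1)%R) ((1 - x) * w == 2)%R = (w != 0)%R)%N.
Proof.
move=> two0; rewrite big_mkcond /=; have [->|w0] := eqVneq w 0.
  by rewrite big1 // => x _; rewrite mulr0 [0 == 2]eq_sym (negPf two0) if_same.
under eq_bigr => x _.
  rewrite (_ : (if _ then _ else _) = nat_of_bool ((x != 1) && ((1 - x) * w == 2))); last by case: (x != 1).
over.
apply: (sum_eq1 _ _ (1 - 2 / w)) => x.
have [->|x1] := eqVneq x 1 => /=.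
  apply/esym/negbTE; rewrite -subr_eq0 opprB addrC subrK.
  by rewrite mulf_neq0 ?invr_neq0.
rewrite -(inj_eq (mulIf w0) _ (1 - _)) mulrBl mul1r mulrBl mul1r divfK //.
by rewrite subr_eq [2 + _]addrC -subr_eq; apply: eq_sym.
Qed.

(* Stereographic projection from [(1, 0, 0)]: a point with [x != 1] is
   [(x, (1 - x) s, (1 - x) t)] where [(1 - x) (1 + s ^ 2 + t ^ 2) = 2]. *)
Lemma sphere_cardE (F : finFieldType) : (2 : F) != 0 ->
  (sphere_card (1 : F)%R + circle_card (-1 : F)%R = #|F| ^ 2 + circle_card (0 : F)%R)%N.
Proof.
move=> two0; rewrite /sphere_card (bigD1 1) //=.
have -> : (\sum_(y : F) \sum_(z : F) (1 ^+ 2 + y ^+ 2 + z ^+ 2 == 1 :> F)%R = circle_card (0 : F)%R)%N.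
  apply: eq_bigr => y _; apply: eq_bigr => z _.
  by rewrite expr1n -addrA -subr_eq0 [1 + _]addrC addrK.
rewrite -addnA addnC; congr addn.
have -> : (\sum_(x : F | (x != 1)%R) \sum_(y : F) \sum_(z : F) (x ^+ 2 + y ^+ 2 + z ^+ 2 == 1)%R
   = \sum_(s : F) \sum_(t : F) \sum_(x : F | (x != 1)%R) ((1 - x) * (1 + s ^+ 2 + t ^+ 2) == 2)%R)%N.
  under [RHS]eq_bigr do rewrite exchange_big /=.
  rewrite [RHS]exchange_big /=; apply: eq_bigr => x x1.
  have u0 : 1 - x != 0 by rewrite subr_eq0 eq_sym.
  rewrite (reindex_inj (mulfI u0)); apply: eq_bigr => s _.
  rewrite (reindex_inj (mulfI u0)); apply: eq_bigr => t _.
  (* After the substitution, the equation of the sphere is that of the line multiplied by the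
     nonzero factor [1 - x]. *)
  rewrite -(inj_eq (mulfI u0) _ 2) -subr_eq0 -[in RHS]subr_eq0.
  by congr nat_of_bool; congr (_ == _); ring.
under eq_bigr do under eq_bigr do rewrite sum_line_param //.
(* The pairs with [s ^ 2 + t ^ 2 = -1] give no point of the sphere and are those counted by the
   circle of -1; together every pair counts once. *)
rewrite /circle_card -big_split /=.
under eq_bigr => s _.
  rewrite -big_split /=.
  under eq_bigr => t _.
    rewrite (_ : (1 + _ + _ != _) = (s ^+ 2 + t ^+ 2 != -1)); last by rewrite -addrA addrC addr_eq0.
    set b := (_ == _); rewrite (_ : (~~ b + b)%N = 1%N); last by case: b.
  over.
  rewrite sum1_card.
over.
by rewrite sum_nat_const.
Qed.

(** With [s = u - i * t] the form becomes [u * (u - 2 * i * t)]. For [u] nonzero exactly one [t]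
    fits; for [u = 0] all do or none, according to whether [c = 0]. *)
Lemma circle_cardE (F : finFieldType) (i c : F) : (2 : F) != 0 -> i ^+ 2 = -1 ->
  (circle_card c = (c == 0)%R * #|F| + #|F|.-1)%N.
Proof.
move=> two0 i2.
have i0 : i != 0 by apply: contraPneq i2 => ->; rewrite expr0n => /eqP; rewrite eq_sym oppr_eq0 oner_eq0.
rewrite /circle_card exchange_big /=.
transitivity (\sum_(t : F) \sum_(u : F) (u * (u - 2 * i * t) == c)%R)%N.
  apply: eq_bigr => t _; rewrite (reindex_inj (addIr (- (i * t)))) /=.
  apply: eq_bigr => u _; congr nat_of_bool; congr (_ == _).
  have -> : (u - i * t) ^+ 2 + t ^+ 2 = u * (u - 2 * i * t) + (i ^+ 2 + 1) * t ^+ 2 by ring.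
  by rewrite i2 addNr mul0r addr0.
rewrite exchange_big (bigD1 0) //=; congr addn.
  under eq_bigr do rewrite mul0r eq_sym.
  by rewrite sum_nat_const mulnC.
rewrite (eq_bigr (fun=> 1%N)); last first.
  move=> u u0; apply: (sum_eq1 _ _ ((u - c / u) / (2 * i))) => t.
  have ti0 : 2 * i != 0 by rewrite mulf_neq0.
  rewrite -(inj_eq (mulIf ti0) t) divfK // -(inj_eq (mulfI u0) (t * _)).
  rewrite mulrBr [u * (u - c / u)]mulrBr [u * (c / u)]mulrC divfK // [2 * i * t]mulrC.
  by rewrite subr_eq [RHS]eq_sym subr_eq [c + _]addrC.
by rewrite sum1_card cardC1.
Qed.

Lemma circle_card0 (F : finFieldType) : (forall i : F, i ^+ 2 != -1) -> circle_card (0 : F)%R = 1%N.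
Proof.
move=> no_i; rewrite /circle_card pair_bigA /=.
apply: (sum_eq1 _ _ ((0, 0))) => -[s t] /=; rewrite xpair_eqE.
have [->|t0] := eqVneq t 0; first by rewrite expr0n addr0 sqrf_eq0 andbT.
rewrite andbF addr_eq0; apply: contraNF (no_i (s / t)) => /eqP st.
by rewrite expr_div_n st mulNr divff // sqrf_eq0.
Qed.

(** The projection used for the sphere, one dimension lower: [1 + s ^ 2] never vanishes, so each
    slope gives one point besides [(1, 0)]. *)
Lemma circle_card1 (F : finFieldType) : (2 : F) != 0 -> (forall i : F, i ^+ 2 != -1) ->
  circle_card (1 : F)%R = #|F|.+1%N.
Proof.
move=> two0 no_i; rewrite /circle_card (bigD1 1) //= -[in RHS]addn1 [LHS]addnC; congr addn; last first.
  apply: (sum_eq1 _ _ (0)) => t.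
  by rewrite expr1n addrC -subr_eq0 addrK sqrf_eq0.
have -> : (\sum_(x : F | (x != 1)%R) \sum_(y : F) (x ^+ 2 + y ^+ 2 == 1)%R
   = \sum_(s : F) \sum_(x : F | (x != 1)%R) ((1 - x) * (1 + s ^+ 2) == 2)%R)%N.
  rewrite [RHS]exchange_big /=; apply: eq_bigr => x x1.
  have u0 : 1 - x != 0 by rewrite subr_eq0 eq_sym.
  rewrite (reindex_inj (mulfI u0)); apply: eq_bigr => s _.
  rewrite -(inj_eq (mulfI u0) _ 2) -subr_eq0 -[in RHS]subr_eq0.
  by congr nat_of_bool; congr (_ == _); ring.
under eq_bigr do rewrite sum_line_param // [1 + _]addrC addr_eq0 no_i.
by rewrite sum1_card.
Qed.

(** Multiplication by [s + t i], of norm -1, carries the circle of norm 1 bijectively onto that of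
    norm -1. *)
Lemma circle_cardN1 (F : finFieldType) (s t : F) : s ^+ 2 + t ^+ 2 = -1 ->
  circle_card (-1 : F)%R = circle_card (1 : F)%R.
Proof.
move=> st; rewrite /circle_card !pair_bigA /=.
pose f (v : F * F) := (s * v.1 - t * v.2, t * v.1 + s * v.2).
rewrite (reindex f) /=; last first.
  exists (fun v => (- (s * v.1 + t * v.2), t * v.1 - s * v.2)) => -[x y] _.
    congr (_, _) => /=.
      have -> : - (s * (s * x - t * y) + t * (t * x + s * y)) = - (s ^+ 2 + t ^+ 2) * x by ring.
      by rewrite st opprK mul1r.
    have -> : t * (s * x - t * y) - s * (t * x + s * y) = - (s ^+ 2 + t ^+ 2) * y by ring.
    by rewrite st opprK mul1r.
  congr (_, _) => /=.
    have -> : s * - (s * x + t * y) - t * (t * x - s * y) = - (s ^+ 2 + t ^+ 2) * x by ring.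
    by rewrite st opprK mul1r.
  have -> : t * - (s * x + t * y) + s * (t * x - s * y) = - (s ^+ 2 + t ^+ 2) * y by ring.
  by rewrite st opprK mul1r.
apply: eq_bigr => -[x y] _ /=; congr nat_of_bool.
have -> : (s * x - t * y) ^+ 2 + (t * x + s * y) ^+ 2 = (s ^+ 2 + t ^+ 2) * (x ^+ 2 + y ^+ 2) by ring.
by rewrite st mulN1r eqr_opp.
Qed.

(** * Square roots of -1 and sums of two squares in finite fields *)

Lemma finField_exp_half (F : finFieldType) (x : F) h : #|F|%N = h.*2.+1%N -> x != 0 ->
  (x ^+ h == 1) || (x ^+ h == -1).
Proof.
move=> Fh x0; rewrite -sqrf_eq1 -exprM muln2.
by rewrite -(inj_eq (mulfI x0)) -exprS -Fh expf_card mulr1.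
Qed.

(** With [#|F| = 2 h + 1], the polynomial [X ^ h - 1] cannot vanish at all [2 h] nonzero elements.
    Some [x] thus has [x ^ h = -1], and [h] is even. *)
Lemma finField_sqrtN1 (F : finFieldType) : (#|F| %% 4 = 1)%N -> exists i : F, i ^+ 2 = -1.
Proof.
move=> F4; pose h := (#|F| %/ 4).*2%N.
have Fh : #|F|%N = h.*2.+1%N by rewrite [LHS](divn_eq _ 4) F4 addn1 /h -!muln2 -mulnA.
have h0 : (0 < h)%N by have := finNzRing_gt1 F; rewrite Fh ltnS double_gt0.
have [/existsP[x /andP[x0 xh]]|/existsPn all1] := boolP [exists x : F, (x != 0) && (x ^+ h != 1)].
  exists (x ^+ (#|F| %/ 4)%N); rewrite -exprM muln2 -/h.
  by have := finField_exp_half _ _ _ Fh x0; rewrite (negPf xh) => /eqP.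
pose rs := enum (predC1 (0 : F)).
have rootrs : all (root ('X^h - 1%:P)) rs.
  apply/allP => x; rewrite mem_enum => x0; have := all1 x.
  by rewrite (x0 : x != 0) /= negbK rootE hornerD hornerXn hornerN hornerC subr_eq0.
have P0 : 'X^h - 1%:P != 0 :> {poly F} by rewrite -size_poly_eq0 size_XnsubC.
have := max_poly_roots P0 rootrs (enum_uniq _).
by rewrite size_XnsubC // -cardE cardC1 Fh /= ltnS -addnn -[X in (_ <= X)%N]addn0 leq_add2l leqNgt h0.
Qed.

(** A root [i] of -1 has [i ^ 4 = 1], so [i ^ #|F|] would be [i ^ 3 = - i], whereas it equals
    [i]. *)
Lemma finField_no_sqrtN1 (F : finFieldType) (i : F) : (#|F| %% 4 = 3)%N -> (2 : F) != 0 -> i ^+ 2 != -1.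
Proof.
move=> F4 two0; apply/eqP => i2.
have i0 : i != 0 by apply: contraPneq i2 => ->; rewrite expr0n => /eqP; rewrite eq_sym oppr_eq0 oner_eq0.
have : i ^+ #|F|%N = i := expf_card i.
rewrite [#|F|%N](divn_eq _ 4) F4 exprD -[4%N]/(2 * 2)%N mulnA exprM mulnC.
rewrite exprM i2 -exprM mulnC exprM sqrrN expr1n expr1n mul1r exprS i2 mulrN1 => /eqP.
by rewrite eq_sym -subr_eq0 opprK -mulr2n -mulr_natr mulf_eq0 (negPf i0) (negPf two0).
Qed.

(** Here [h = (#|F| - 1) / 2] is odd, so [d ^ ((h + 1) / 2)] is a square root of [d] whenever
    [d ^ h = 1], and one of [c], [- c] satisfies this. *)
Lemma finField_sqrtVN (F : finFieldType) (c : F) : (#|F| %% 4 = 3)%N ->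
  exists a : F, a ^+ 2 = c \/ a ^+ 2 = - c.
Proof.
move=> F4; have [->|c0] := eqVneq c 0; first by exists 0; left; rewrite expr0n.
pose k := (#|F| %/ 4)%N.
have Fh : #|F|%N = k.*2.+1.*2.+1%N by rewrite [LHS](divn_eq _ 4) F4 -/k -!muln2; lia.
have sqE (d : F) : d ^+ k.*2.+1 = 1 -> (d ^+ k.+1) ^+ 2 = d.
  by move=> dh; rewrite -exprM muln2 doubleS exprS dh mulr1.
have /orP[/eqP ch|/eqP ch] := finField_exp_half _ _ _ Fh c0.
  by exists (c ^+ k.+1); left; apply: sqE.
exists ((- c) ^+ k.+1); right; apply: sqE.
by rewrite exprNn ch -signr_odd /= odd_double expr1 mulrNN mulr1.
Qed.

Lemma finField_sum_sqN1 (F : finFieldType) : (#|F| %% 4 = 3)%N ->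
  exists s t : F, s ^+ 2 + t ^+ 2 = -1.
Proof.
move=> F4.
have [/existsP[s /existsP[t /eqP]]|no_st] :=
  boolP [exists s : F, exists t : F, s ^+ 2 + t ^+ 2 == -1]; first by exists s, t.
(* Otherwise each [s ^ 2 + 1] is a square, hence so is every [k%:R]. *)
have sq k : exists a : F, a ^+ 2 = k%:R.
  elim: k => [|k [s sk]]; first by exists 0; rewrite expr0n.
  have [a [|aN]] := finField_sqrtVN _ (k.+1%:R) F4; first by exists a.
  case/existsP: no_st; exists s; apply/existsP; exists a; rewrite aN sk.
  by rewrite -addn1 natrD opprD addrA subrr add0r.
(* In characteristic [p], -1 is the image of [p - 1], hence a square, which is a sum of two squares
   after all. *)
have [p pp pF] := finPcharP F.
have [a aN] := sq p.-1%N; case/existsP: no_st; exists 0; apply/existsP; exists a.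
by rewrite expr0n add0r aN -addr_eq0 natr1 prednK ?prime_gt0 // pcharf0.
Qed.

(** With [q = #|F|], the circles of -1 and 0 have [q - 1] and [2 q - 1] points if -1 is a square,
    and [q + 1] and 1 points otherwise. *)
Lemma sphere_card_prime (F : finFieldType) : (2 : F) != 0 ->
  (#|F| %% 4 = 1 -> sphere_card (1%R : F) = #|F| ^ 2 + #|F|)%N *
  (#|F| %% 4 = 3 -> sphere_card (1%R : F) + #|F| = #|F| ^ 2)%N.
Proof.
move=> two0; have sE := sphere_cardE _ two0; split => F4.
  have [i i2] := finField_sqrtN1 _ F4.
  move: sE; rewrite !(circle_cardE _ _ _ two0 i2) oppr_eq0 oner_eq0 eqxx mul0n mul1n add0n.
  by rewrite addnA => /addIn.
have no_i (i : F) : i ^+ 2 != -1 by exact: finField_no_sqrtN1.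
have [s [t st]] := finField_sum_sqN1 _ F4.
move: sE; rewrite (circle_cardN1 _ _ _ st) circle_card1 // circle_card0 //.
by rewrite -addn1 addnA => /addIn.
Qed.

Lemma N3_sphere_card p : prime p -> N3 1 p = sphere_card (1 : 'F_p).
Proof.
move=> pp; rewrite N3E /sphere_card.
have sumE (G : 'F_p -> nat) : (\sum_(a : 'F_p) G a = \sum_(i < p) G i%:R)%N.
  (* The bound of the ordinal type behind ['F_p] equals [p] only through a rewriting, which is done
     on sums of functions of [nat] to avoid casts. *)
  have sum_cast (g : nat -> nat) :
    (\sum_(i < (Zp_trunc (pdiv p)).+2) g i = \sum_(i < p) g i)%N by rewrite Fp_cast.
  rewrite -(sum_cast (fun i => G i%:R)).
  by apply: eq_bigr => i _; rewrite natr_Zp.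
rewrite sumE; apply: eq_bigr => i _; rewrite sumE; apply: eq_bigr => j _.
rewrite sumE; apply: eq_bigr => k _; congr nat_of_bool.
by rewrite -!natrX -!natrD -[1]/(1%:R) -(inj_eq val_inj) /= !val_Fp_nat // (Fp_cast pp).
Qed.

Lemma N3_prime p : prime p -> odd p ->
  (p %% 4 = 1 -> N3 1 p = p ^ 2 + p)%N * (p %% 4 = 3 -> N3 1 p + p = p ^ 2)%N.
Proof.
move=> pp op; rewrite N3_sphere_card //.
have two0 : (2 : 'F_p) != 0.
  rewrite -(dvdn_pcharf (pchar_Fp pp)) dvdn_prime2 //.
  by apply: contraTneq op => ->.
have := sphere_card_prime _ two0.
by rewrite (card_Fp pp).
Qed.

(** * Squarefree divisor sums *)

(** Note that [sqfree 0] holds, since [primes 0] is empty. *)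
Definition sqfree (n : nat) : bool := all (fun p => logn p n <= 1)%N (primes n).

Definition chi4 {R : pzRingType} (n : nat) : R := if odd n then (-1) ^+ n./2 else 0.

Definition sqfree_sum {R : realFieldType} (r : nat) : R :=
  \sum_(d <- divisors r | sqfree d) chi4 d / d%:R.

Lemma sqfreeP n : reflect (forall p, prime p -> (logn p n <= 1)%N) (sqfree n).
Proof.
apply: (iffP allP) => [sq p pp|sq p]; last by rewrite mem_primes => /andP[/sq].
have [/sq//|] := boolP (p \in primes n).
by rewrite -logn_gt0 -eqn0Ngt => /eqP ->.
Qed.

Lemma sqfree_primeMl p d : prime p -> (0 < d)%N ->
  sqfree (p * d) = ~~ (p %| d)%N && sqfree d.
Proof.
move=> pp d0; have p0 := prime_gt0 pp.
apply/sqfreeP/andP => [sq|[pd /sqfreeP sq] q qp]; last first.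
  rewrite lognM // logn_prime //; have [->|_] := eqVneq; last exact: sq.
  by rewrite (_ : logn p d = 0%N) //; apply/eqP; rewrite eqn0Ngt logn_gt0 mem_primes pp d0 /=.
split.
  have := sq p pp; rewrite lognM // logn_prime // eqxx add1n ltnS leqn0 => /eqP l0.
  apply/negP => pd; have : (0 < logn p d)%N by rewrite logn_gt0 mem_primes pp d0.
  by rewrite l0.
apply/sqfreeP => q qp; apply: leq_trans (sq q qp).
by rewrite lognM // leq_addl.
Qed.

Lemma chi4M (R : comPzRingType) m n : chi4 (m * n) = chi4 m * chi4 n :> R.
Proof.
rewrite /chi4 oddM; case: ifP => [/andP[om on]|]; last first.
  by case: (odd m); rewrite ?mul0r //= => ->; rewrite mulr0.
rewrite om on -exprD.
have -> : ((m * n)./2 = (m./2 * n./2).*2 + (m./2 + n./2))%N.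
  by rewrite -{1}(odd_double_half m) -{1}(odd_double_half n) om on; lia.
by rewrite exprD -mul2n exprM sqrrN !expr1n mul1r.
Qed.

Lemma sqfree_sumE (R : realFieldType) r :
  sqfree_sum r = \sum_(d <- [seq d <- divisors r | sqfree d]) chi4 d / d%:R :> R.
Proof. by rewrite big_filter. Qed.

(** A squarefree divisor of [p * r] contains [p] at most once, so it divides [r] already. *)
Lemma sqfree_sum_primeMl_dvd (R : realFieldType) p r : prime p -> (0 < r)%N -> (p %| r)%N ->
  sqfree_sum (p * r) = sqfree_sum r :> R.
Proof.
move=> pp r0 pr; have p0 := prime_gt0 pp; rewrite !sqfree_sumE.
apply: perm_big; apply: uniq_perm; rewrite ?filter_uniq ?divisors_uniq // => d.
rewrite !mem_filter -!dvdn_divisors ?muln_gt0 ?p0 //.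
case sqd: (sqfree d) => //=.
apply/idP/idP => [|/dvdn_mull->//].
have [pd|pd] := boolP (p %| d)%N; last first.
  by rewrite Gauss_dvdr // coprime_sym prime_coprime.
move: pd sqd => /dvdnP[e ->]; rewrite mulnC.
have [->|e0] := posnP e; first by rewrite muln0 dvd0n muln_eq0 !eqn0Ngt r0 p0.
rewrite sqfree_primeMl // => /andP[pe _]; rewrite dvdn_pmul2l // => er.
by rewrite Gauss_dvd ?prime_coprime // pr.
Qed.

(** The divisors of [p * r] are the divisors [d] of [r] and the products [p * d]; the latter
    contribute the factor [chi4 p / p]. *)
Lemma sqfree_sum_primeMl (R : realFieldType) p r : prime p -> (0 < r)%N -> ~~ (p %| r)%N ->
  sqfree_sum (p * r) = (1 + chi4 p / p%:R) * sqfree_sum r :> R.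
Proof.
move=> pp r0 pr; have p0 := prime_gt0 pp.
have divE : perm_eq (divisors (p * r)) (divisors r ++ [seq (p * d)%N | d <- divisors r]).
  apply: uniq_perm; rewrite ?divisors_uniq //.
    rewrite cat_uniq divisors_uniq map_inj_uniq ?divisors_uniq ?andbT /=; last first.
      by move=> a b /eqP; rewrite eqn_pmul2l // => /eqP.
    apply/hasPn => _ /mapP[d _ ->]; rewrite -dvdn_divisors //.
    by apply: contraNN pr => /(dvdn_trans (dvdn_mulr _ (dvdnn p))).
  move=> d; rewrite mem_cat -!dvdn_divisors ?muln_gt0 ?p0 //.
  apply/idP/orP => [dpr|[/dvdn_mull->//|/mapP[e + ->]]]; last first.
    by rewrite -dvdn_divisors // dvdn_pmul2l.
  have [pd|pd] := boolP (p %| d)%N; last first.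
    by left; rewrite -(Gauss_dvdr r (m := d) (n := p)) // coprime_sym prime_coprime.
  right; apply/mapP; move: dpr; have /dvdnP[e ->] := pd; rewrite mulnC => dpr.
  by exists e => //; rewrite -dvdn_divisors // -(dvdn_pmul2l p0).
rewrite /sqfree_sum (perm_big _ divE) /= big_cat big_map mulrDl mul1r; congr (_ + _).
rewrite mulr_sumr big_seq_cond [RHS]big_seq_cond.
have divr d : d \in divisors r -> (0 < d)%N && ~~ (p %| d)%N.
  rewrite -dvdn_divisors // => dr; rewrite (dvdn_gt0 r0 dr).
  by apply: contraNN pr => /dvdn_trans; apply.
apply: eq_big => [d|d /andP[/divr/andP[d0 pd] _]].
  have [/divr/andP[d0 pd]|//] := boolP (d \in _).
  by rewrite sqfree_primeMl // pd.
by rewrite chi4M natrM invfM mulrACA.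
Qed.

Lemma sqfree_sum_2Ml (R : realFieldType) r : (0 < r)%N ->
  sqfree_sum (2 * r) = sqfree_sum r :> R.
Proof.
move=> r0; have [r2|r2] := boolP (2 %| r)%N; first exact: sqfree_sum_primeMl_dvd.
by rewrite sqfree_sum_primeMl // /chi4 /= mul0r addr0 mul1r.
Qed.

Lemma sqfree_sum1 (R : realFieldType) : sqfree_sum 1 = 1 :> R.
Proof. by rewrite /sqfree_sum big_cons big_nil /= /chi4 /= divr1 addr0. Qed.

Lemma chi4_odd_prime (R : comPzRingType) p : odd p ->
  ((p %% 4 = 1)%N -> chi4 p = 1 :> R) * ((p %% 4 = 3)%N -> chi4 p = -1 :> R).
Proof.
move=> op; rewrite /chi4 op -signr_odd; split => p4; rewrite (divn_eq p 4) p4.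
  have -> : ((p %/ 4 * 4 + 1)./2 = (p %/ 4).*2)%N by lia.
  by rewrite odd_double.
have -> : ((p %/ 4 * 4 + 3)./2 = (p %/ 4).*2.+1)%N by lia.
by rewrite /= odd_double.
Qed.

Lemma N3_prime_chi4 (R : realFieldType) p : prime p -> odd p ->
  (N3 1 p)%:R = p%:R ^+ 2 * (1 + chi4 p / p%:R) :> R.
Proof.
move=> pp op; have p0 : p%:R != 0 :> R by rewrite pnatr_eq0 -lt0n prime_gt0.
have -> : p%:R ^+ 2 * (1 + chi4 p / p%:R) = p%:R ^+ 2 + chi4 p * p%:R :> R by field.
have [N1 N3] := N3_prime _ pp op; have [c1 c3] := chi4_odd_prime R _ op.
have [p4|p4] : (p %% 4 = 1 \/ p %% 4 = 3)%N by have := ltn_pmod p (isT : (0 < 4)%N); lia.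
  by rewrite N1 // c1 // mul1r natrD natrX.
by rewrite c3 // mulN1r -natrX -N3 // natrD addrK.
Qed.

(** Strong induction, removing one odd prime factor at a time, by lifting or by coprimality. Powers
    of 2 remain: up to 8 they are computed, beyond that they are lifted. *)
Lemma N3_sqfree_sum (R : realFieldType) r : (0 < r)%N ->
  (N3 1 r)%:R = r%:R ^+ 2 * (1 + (4 %| r)%N%:R / 2) * sqfree_sum r :> R.
Proof.
elim/ltn_ind: r => r IH r0.
have [/hasP[p]|/hasPn] := boolP (has odd (primes r)).
  rewrite mem_primes => /and3P[pp _ /dvdnP[s rE]] op.
  have p0 := prime_gt0 pp; rewrite mulnC in rE.
  have s0 : (0 < s)%N by move: r0; rewrite rE muln_gt0 => /andP[].
  have sr : (s < r)%N by rewrite rE ltn_Pmull // prime_gt1.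
  have {}IH := IH s sr s0.
  have d4 : (4 %| r)%N = (4 %| s)%N.
    by rewrite rE Gauss_dvdr // (coprimeXl 2 (m := 2)) // prime_coprime // dvdn2 op.
  have [ps|ps] := boolP (p %| s)%N.
    rewrite d4 rE N3_lift_odd // natrM IH sqfree_sum_primeMl_dvd // natrX natrM exprMn.
    by rewrite !mulrA.
  rewrite d4 rE N3_coprime ?prime_coprime // natrM IH sqfree_sum_primeMl //.
  by rewrite N3_prime_chi4 // natrM exprMn; ring.
move=> ev.
have /p_natP[k rE] : 2%N.-nat r.
  apply/pnatP => // p pp pr; rewrite inE /=.
  have := ev p; rewrite mem_primes pp r0 pr => /(_ isT).
  by case: (even_prime pp) => [->|->].
move: rE IH; case: k => [|[|[|[|k]]]] -> IH.
- by rewrite N3_1 sqfree_sum1 /= mul0r addr0 expr1n !mulr1.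
- by rewrite (sqfree_sum_2Ml R 1) // N3_2 sqfree_sum1 /=; field.
- by rewrite (sqfree_sum_2Ml R 2) // (sqfree_sum_2Ml R 1) // N3_4 sqfree_sum1 /=; field.
- by rewrite (sqfree_sum_2Ml R 4) // (sqfree_sum_2Ml R 2) // (sqfree_sum_2Ml R 1) // N3_8 sqfree_sum1 /=; field.
have s0 : (0 < 2 ^ k.+3)%N by rewrite expn_gt0.
have d4 m : (4 %| 2 ^ m.+2)%N by rewrite (dvdn_exp2l 2 (m := 2)).
have IHs : (2 ^ k.+3 < 2 ^ k.+4)%N by rewrite ltn_exp2l.
rewrite expnS N3_lift_2 // ?(dvdn_exp2l 2 (m := 3)) // sqfree_sum_2Ml //.
rewrite natrM (IH _ IHs s0) -expnS !d4 [in RHS]expnS natrM natrX.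
by rewrite exprMn !mulrA.
Qed.

(** * Summation over the moduli *)

Lemma sum_dvd_reindex (R : nmodType) (d n : nat) (F : nat -> R) : (0 < d)%N ->
  \sum_(1 <= r < n.+1 | (d %| r)%N) F r = \sum_(1 <= m < (n %/ d).+1) F (d * m)%N.
Proof.
move=> d0; rewrite -[LHS]big_filter -(big_map (muln d) xpredT F); apply: perm_big.
apply: uniq_perm; first by rewrite filter_uniq ?iota_uniq.
  by rewrite map_inj_uniq ?iota_uniq // => a b /eqP; rewrite eqn_pmul2l // => /eqP.
move=> r; rewrite mem_filter mem_index_iota ltnS; apply/idP/mapP.
  case/and3P => /dvdnP[m ->] m0 mn; exists m; last exact: mulnC.
  by rewrite mem_index_iota ltnS leq_divRL // mn andbT; case: m m0 {mn}.
case=> m; rewrite mem_index_iota ltnS leq_divRL // => /andP[m0 mn] ->.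
by rewrite dvdn_mulr // muln_gt0 d0 m0 mulnC.
Qed.

(** A range independent of [r] allows the sums over [r] and [d] to be exchanged. *)
Lemma sum_divisors (R : nmodType) (r n : nat) (P : pred nat) (F : nat -> R) : (0 < r <= n)%N ->
  \sum_(d <- divisors r | P d) F d = \sum_(1 <= d < n.+1 | (d %| r)%N && P d) F d.
Proof.
case/andP=> r0 rn; rewrite -[LHS]big_filter -[RHS]big_filter; apply: perm_big.
apply: uniq_perm; rewrite ?filter_uniq ?divisors_uniq ?iota_uniq // => d.
rewrite !mem_filter mem_index_iota -dvdn_divisors // ltnS.
case: (P d); case dr: (d %| r)%N => //=.
by rewrite (dvdn_gt0 r0 dr) (leq_trans (dvdn_leq r0 dr) rn).
Qed.

Definition sqfree_weighted_sum {R : realFieldType} (n : nat) : R :=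
  \sum_(1 <= r < n.+1) r%:R ^+ 2 * sqfree_sum r.

(** At [r = 4 m] the extra term is half of [16 m ^ 2 * sqfree_sum m], as factors 2 do not change
    [sqfree_sum]. *)
Lemma sum_N3 (R : realFieldType) n :
  \sum_(1 <= r < n.+1) (N3 1 r)%:R =
  sqfree_weighted_sum n + 8 * sqfree_weighted_sum (n %/ 4) :> R.
Proof.
have -> : \sum_(1 <= r < n.+1) (N3 1 r)%:R =
    \sum_(1 <= r < n.+1) (r%:R ^+ 2 * sqfree_sum r
      + if (4 %| r)%N then r%:R ^+ 2 * sqfree_sum r / 2 else 0) :> R.
  rewrite !big_nat; apply: eq_bigr => r /andP[r0 _].
  rewrite N3_sqfree_sum //; case: ifP => _ /=; by field.
rewrite big_split /=; congr (_ + _).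
rewrite -big_mkcond sum_dvd_reindex // /sqfree_weighted_sum mulr_sumr.
rewrite !big_nat; apply: eq_bigr => m /andP[m0 _].
rewrite -[(4 * m)%N](mulnA 2 2 m) !sqfree_sum_2Ml ?muln_gt0 // !natrM.
by field.
Qed.

Lemma sqfree_weighted_sumE (R : realFieldType) n :
  sqfree_weighted_sum n = \sum_(1 <= d < n.+1 | sqfree d)
    chi4 d * d%:R * \sum_(1 <= m < (n %/ d).+1) m%:R ^+ 2 :> R.
Proof.
rewrite /sqfree_weighted_sum.
transitivity (\sum_(1 <= r < n.+1) \sum_(1 <= d < n.+1 | sqfree d)
    if (d %| r)%N then r%:R ^+ 2 * (chi4 d / d%:R) else 0 :> R).
  rewrite !big_nat; apply: eq_bigr => r rn; rewrite /sqfree_sum (sum_divisors _ _ n) //.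
  by rewrite mulr_sumr -big_mkcondr; apply: eq_bigl => d; rewrite andbC.
rewrite exchange_big /= [LHS]big_nat_cond [RHS]big_nat_cond; apply: eq_bigr => d /andP[/andP[d0 _] _].
rewrite -big_mkcond sum_dvd_reindex // mulr_sumr; apply: eq_bigr => m _.
by rewrite natrM; field; rewrite pnatr_eq0 -lt0n.
Qed.

Lemma sum_sq_bound (R : realFieldType) (k : nat) (z : R) : k%:R <= z < k.+1%:R ->
  `|\sum_(1 <= m < k.+1) m%:R ^+ 2 - z ^+ 3 / 3| <= z ^+ 2.
Proof.
move=> /andP[kz zk].
have -> : \sum_(1 <= m < k.+1) m%:R ^+ 2 = k%:R ^+ 3 / 3 + k%:R ^+ 2 / 2 + k%:R / 6 :> R.
  elim: k {kz zk} => [|k IH]; first by rewrite big_geq // mulr0n; ring.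
  by rewrite big_nat_recr //= IH -natr1; field.
move: kz zk; rewrite -natr1; set c : R := k%:R => cz zc.
have c0 : 0 <= c by rewrite /c.
have z0 : 0 <= z by apply: le_trans cz.
(* This uses that [c] is a natural number; it bounds the lower-order part [c ^ 2 / 2 + c / 6] by a
   multiple of [c ^ 2]. *)
have cc : c <= c ^+ 2 by rewrite /c -natrX ler_nat; case: k {c c0 z0 cz zc} => // k; rewrite leq_pmulr.
have c2 : c ^+ 2 <= z ^+ 2 by rewrite lerXn2r.
have c3 : c ^+ 3 <= z ^+ 3 by rewrite lerXn2r.
have zc2 : z * c <= z ^+ 2 by rewrite expr2 ler_wpM2l.
have z3 : z ^+ 3 - c ^+ 3 <= 3 * z ^+ 2.
  have -> : z ^+ 3 - c ^+ 3 = (z - c) * (z ^+ 2 + z * c + c ^+ 2) by ring.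
  apply: (@le_trans _ _ (1 * (z ^+ 2 + z * c + c ^+ 2))); last by lra.
  apply: ler_wpM2r; last by lra.
  by rewrite !addr_ge0 ?mulr_ge0 ?exprn_ge0.
have c20 : 0 <= c ^+ 2 by rewrite exprn_ge0.
by rewrite ler_norml; apply/andP; split; lra.
Qed.

Lemma chi4_norm (R : realFieldType) n : `|chi4 n| <= 1 :> R.
Proof. by rewrite /chi4; case: ifP => _; rewrite ?normr0 // normrX normrN1 expr1n. Qed.

Definition sqfree_L2 {R : realFieldType} (n : nat) : R :=
  \sum_(1 <= d < n.+1 | sqfree d) chi4 d / d%:R ^+ 2.

Definition harmonic_sum {R : realFieldType} (n : nat) : R := \sum_(1 <= d < n.+1) d%:R^-1.

(** Replacing each inner sum of squares by [(y / d) ^ 3 / 3] costs at most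
    [d * (y / d) ^ 2 = y ^ 2 / d], whence the harmonic sum. The other term is the truncation error
    of the series for [D]. *)
Lemma sqfree_weighted_sum_bound (R : realFieldType) (n : nat) (y D : R) :
  n%:R <= y < n.+1%:R ->
  `|sqfree_weighted_sum n - D * y ^+ 3 / 3| <=
    y ^+ 2 * harmonic_sum n + y ^+ 3 / 3 * `|sqfree_L2 n - D|.
Proof.
move=> /andP[ny yn]; have y0 : 0 <= y by apply: le_trans ny.
have -> : sqfree_weighted_sum n - D * y ^+ 3 / 3 =
   (sqfree_weighted_sum n - sqfree_L2 n * y ^+ 3 / 3) + y ^+ 3 / 3 * (sqfree_L2 n - D) by field.
apply: le_trans (ler_normD _ _) _; apply: lerD; last first.
  by rewrite normrM [`|_ / 3|]ger0_norm // divr_ge0 // exprn_ge0.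
rewrite sqfree_weighted_sumE /sqfree_L2 -mulrA mulr_suml -sumrB /harmonic_sum mulr_sumr.
apply: le_trans (ler_norm_sum _ _ _) _.
rewrite big_mkcond !big_nat; apply: ler_sum => d /andP[d0 dn].
have d0' : 0 < d%:R :> R by rewrite ltr0n.
case: ifP => _; last by rewrite mulr_ge0 ?invr_ge0 ?exprn_ge0.
have -> : chi4 d * d%:R * \sum_(1 <= m < (n %/ d).+1) m%:R ^+ 2 - chi4 d / d%:R ^+ 2 * (y ^+ 3 / 3)
   = chi4 d * d%:R * (\sum_(1 <= m < (n %/ d).+1) m%:R ^+ 2 - (y / d%:R) ^+ 3 / 3) :> R.
  by field; rewrite gt_eqF.
rewrite !normrM (gtr0_norm d0').
have -> : y ^+ 2 / d%:R = 1 * d%:R * (y / d%:R) ^+ 2 by field; rewrite gt_eqF.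
apply: ler_pM; rewrite ?mulr_ge0 ?normr_ge0 //; first by rewrite ler_pM2r // chi4_norm.
(* Since [n] is the integer part of [y], [n %/ d] is that of [y / d]. *)
apply: sum_sq_bound; rewrite ler_pdivlMr // ltr_pdivrMr // -!natrM; apply/andP; split.
  by apply: le_trans ny; rewrite ler_nat leq_divM.
by apply: lt_le_trans yn _; rewrite ler_nat ltn_ceil.
Qed.

(** * Squarefree parts and the value of the series over squarefree numbers *)

Lemma sqfree_decomp n : (0 < n)%N -> exists d e, [/\ sqfree d, (0 < e)%N & n = (d * e ^ 2)%N].
Proof.
elim/ltn_ind: n => n IH n0.
have [sq|/allPn[p + lp]] := boolP (sqfree n); first by exists n, 1%N; rewrite muln1.
rewrite mem_primes => /and3P[pp _ _]; have p1 := prime_gt1 pp.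
have /dvdnP[m nE] : (p ^ 2 %| n)%N by rewrite pfactor_dvdn // ltnNge.
have m0 : (0 < m)%N by move: n0; rewrite nE muln_gt0 => /andP[].
have mn : (m < n)%N by rewrite nE -[X in (X < _)%N]muln1 ltn_pmul2l // -(exp1n 2) ltn_exp2r.
have [d [e [sqd e0 mE]]] := IH m mn m0.
by exists d, (e * p)%N; rewrite muln_gt0 e0 (ltnW p1); split=> //; rewrite nE mE expnMn mulnA.
Qed.

(** The exponent of a prime in [d] is 0 or 1, so it is the parity of its exponent in [d * e ^ 2]. *)
Lemma sqfree_decomp_inj d e d' e' : (0 < d)%N -> (0 < e)%N -> (0 < d')%N -> (0 < e')%N ->
  sqfree d -> sqfree d' -> (d * e ^ 2 = d' * e' ^ 2)%N -> d = d' /\ e = e'.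
Proof.
move=> d0 e0 d'0 e'0 /sqfreeP sq /sqfreeP sq' E.
have dd : d = d'.
  apply: eqn_from_log => // p; have [pp|pp] := boolP (prime p); last by rewrite [LHS]lognE [RHS]lognE (negPf pp).
  move: (sq p pp) (sq' p pp) (congr1 (logn p) E).
  by rewrite !lognM ?muln_gt0 ?e0 ?e'0 //; lia.
split=> //; move: E; rewrite dd => /eqP; rewrite eqn_pmul2l // eqn_exp2r // => /eqP.
exact: id.
Qed.

Lemma ler_sum_subset (R : realFieldType) (s t : seq nat) (F : nat -> R) :
  uniq s -> uniq t -> {subset s <= t} -> (forall x, 0 <= F x) ->
  \sum_(x <- s) F x <= \sum_(x <- t) F x.
Proof.
move=> us ut st F0.
have -> : \sum_(x <- s) F x = \sum_(x <- t | x \in s) F x.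
  rewrite -[RHS]big_filter; apply: perm_big; apply: uniq_perm; rewrite ?filter_uniq // => x.
  by rewrite mem_filter; case xs: (x \in s) => //=; rewrite st.
by rewrite [leLHS]big_mkcond; apply: ler_sum => x _; case: ifP.
Qed.

Lemma sum_inv_sq_le (R : realFieldType) (m n : nat) : (0 < m)%N ->
  \sum_(m.+1 <= k < n.+1) k%:R ^- 2 <= m%:R^-1 :> R.
Proof.
move=> m0; have [nm|/ltnW mn] := leqP n m.
  by rewrite big_geq // invr_ge0.
(* Keeping the telescoping remainder makes the induction go through:
   [1 / (a + 1) ^ 2 <= 1 / a - 1 / (a + 1)]. *)
suff H j : \sum_(m.+1 <= k < (m + j).+1) k%:R ^- 2 <= m%:R^-1 - (m + j)%:R^-1 :> R.
  rewrite -(subnKC mn); apply: le_trans (H _) _.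
  by rewrite lerBlDr lerDl invr_ge0.
elim: j => [|j IH]; first by rewrite addn0 big_geq // subrr.
rewrite addnS big_nat_recr /= ?ltnS ?leq_addr //; move: IH.
have a0 : 0 < (m + j)%:R :> R by rewrite ltr0n addn_gt0 m0.
rewrite -[(m + j).+1%:R]natr1; move: (m + j)%:R a0 => a a0.
suff : (a + 1) ^- 2 <= a^-1 - (a + 1)^-1 by lra.
have a_neq0 : a != 0 by rewrite gt_eqF.
have a1_neq0 : a + 1 != 0 by rewrite gt_eqF ?addr_gt0.
have -> : a^-1 - (a + 1)^-1 = (a * (a + 1))^-1 by field; rewrite a_neq0 a1_neq0.
rewrite lef_pV2 ?posrE ?exprn_gt0 ?mulr_gt0 ?addr_gt0 //.
by rewrite expr2 ler_pM2r ?addr_gt0 // lerDl.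
Qed.

Definition odd_zeta4 {R : realFieldType} (n : nat) : R :=
  \sum_(1 <= e < n.+1 | odd e) e%:R ^- 4.

Definition chi4_L2 {R : realFieldType} (n : nat) : R :=
  \sum_(1 <= k < n.+1) chi4 k / k%:R ^+ 2.

Lemma chi4_mul_sq (R : realFieldType) d e :
  chi4 (d * e ^ 2) = if odd e then chi4 d else 0 :> R.
Proof.
rewrite -[(e ^ 2)%N]/(e * e)%N !chi4M [chi4 e]/chi4; case: ifP => _; last by rewrite !mulr0.
by rewrite -expr2 sqrr_sign mulr1.
Qed.

(** The product expands over the numbers [d * e ^ 2] with [d, e <= M]. These are distinct and
    include every positive [n <= M]; the others exceed [M], so a tail of the sum of [1 / n ^ 2]
    bounds the error. *)
Lemma sqfree_L2_odd_zeta4 (R : realFieldType) (M : nat) : (0 < M)%N ->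
  `|sqfree_L2 M * odd_zeta4 M - chi4_L2 M| <= M%:R^-1 :> R.
Proof.
move=> M0; pose F n : R := chi4 n / n%:R ^+ 2.
pose I := index_iota 1 M.+1.
have mI x : (x \in I) = (0 < x <= M)%N by rewrite mem_index_iota ltnS.
pose L := [seq (d * e ^ 2)%N | d <- [seq d <- I | sqfree d], e <- I].
(* [L] also lists even [e], where [F] vanishes. *)
have LE : sqfree_L2 M * odd_zeta4 M = \sum_(n <- L) F n.
  rewrite big_allpairs_dep big_filter /sqfree_L2 mulr_suml -/I /=; apply: eq_bigr => d _.
  rewrite /odd_zeta4 big_mkcond mulr_sumr !big_nat; apply: eq_bigr => e /andP[e0 _].
  rewrite /F chi4_mul_sq; case: ifP => _; last by rewrite mulr0 mul0r.
  by rewrite natrM natrX exprMn -exprM [in RHS]invfM mulrA.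
have uL : uniq L.
  apply: allpairs_uniq; rewrite ?filter_uniq ?iota_uniq //.
  move=> [d e] [d' e'] /allpairsP[[a b] /= [+ + [-> ->]]] /allpairsP[[a' b'] /= [+ + [-> ->]]].
  rewrite !mem_filter !mI => /andP[sa /andP[a0 _]] /andP[b0 _] /andP[sa' /andP[a'0 _]] /andP[b'0 _].
  by move=> /(sqfree_decomp_inj _ _ _ _ a0 b0 a'0 b'0 sa sa') [-> ->].
have memL n : n \in L -> (0 < n <= M * M ^ 2)%N.
  case/allpairsP => -[d e] /= []; rewrite mem_filter !mI => /andP[_ /andP[d0 dM]] /andP[e0 eM] ->.
  by rewrite muln_gt0 expn_gt0 d0 e0 leq_mul // leq_exp2r.
have subL n : (0 < n <= M)%N -> n \in L.
  move=> /andP[n0 nM]; have [d [e [sd e0 nE]]] := sqfree_decomp _ n0.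
  have d0 : (0 < d)%N by move: n0; rewrite nE muln_gt0 => /andP[].
  apply/allpairsP; exists (d, e); rewrite /= mem_filter sd !mI d0 e0 /=; split=> //.
    by apply: leq_trans nM; rewrite nE leq_pmulr // expn_gt0 e0.
  apply: leq_trans nM; rewrite nE; apply: leq_trans (leq_pmull _ d0).
  by rewrite -[X in (X <= _)%N]expn1 leq_pexp2l.
rewrite LE (bigID (fun n => n <= M)%N) /=.
have -> : \sum_(n <- L | (n <= M)%N) F n = chi4_L2 M.
  rewrite -big_filter; apply: perm_big; apply: uniq_perm; rewrite ?filter_uniq ?iota_uniq // => n.
  rewrite mem_filter -/I mI; apply/andP/andP => [[nM /memL/andP[n0 _]]|[n0 nM]] //.
  by split=> //; apply: subL; rewrite n0.
rewrite addrAC subrr add0r; apply: le_trans (ler_norm_sum _ _ _) _.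
apply: (@le_trans _ _ (\sum_(n <- [seq n <- L | ~~ (n <= M)%N]) n%:R ^- 2)).
  rewrite big_filter; apply: ler_sum => n _.
  rewrite normrM normfV [`|n%:R ^+ 2|]ger0_norm ?exprn_ge0 //.
  by rewrite ler_piMl ?invr_ge0 ?exprn_ge0 // chi4_norm.
apply: le_trans (sum_inv_sq_le _ _ (M * M ^ 2) M0).
apply: ler_sum_subset => [||n|n]; rewrite ?filter_uniq ?iota_uniq ?invr_ge0 ?exprn_ge0 //.
by rewrite mem_filter mem_index_iota ltnS -ltnNge => /andP[-> /memL/andP[]].
Qed.

Lemma sqfree_L2_dist (R : realFieldType) (m n : nat) : (0 < m <= n)%N ->
  `|sqfree_L2 n - sqfree_L2 m| <= m%:R^-1 :> R.
Proof.
move=> /andP[m0 mn]; rewrite /sqfree_L2 (big_cat_nat (n := m.+1)) //= addrAC subrr add0r.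
apply: le_trans (ler_norm_sum _ _ _) _; apply: le_trans (sum_inv_sq_le _ _ n m0).
rewrite big_mkcond; apply: ler_sum => k _; case: ifP => _; last by rewrite invr_ge0 exprn_ge0.
rewrite normrM normfV [`|k%:R ^+ 2|]ger0_norm ?exprn_ge0 //.
by rewrite ler_piMl ?invr_ge0 ?exprn_ge0 // chi4_norm.
Qed.

Lemma odd_zeta4_double (R : realFieldType) k :
  odd_zeta4 k.*2 = \sum_(j < k) (2 * j + 1)%:R ^- 4 :> R.
Proof.
elim: k => [|k IH]; first by rewrite /odd_zeta4 big_geq // big_ord0.
rewrite /odd_zeta4 doubleS 2?big_mkcond /= 2?big_nat_recr //= -big_mkcond.
by rewrite -/(odd_zeta4 k.*2) IH big_ord_recr /= negbK odd_double /= addr0 addn1 mul2n.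
Qed.

Lemma chi4_L2_double (R : realFieldType) k :
  chi4_L2 k.*2 = \sum_(0 <= j < k) (-1) ^+ j / (2 * j + 1)%:R ^+ 2 :> R.
Proof.
elim: k => [|k IH]; first by rewrite /chi4_L2 !big_geq.
rewrite /chi4_L2 doubleS 2?big_nat_recr //= -/(chi4_L2 k.*2) IH.
by rewrite [RHS]big_nat_recr //= /chi4 /= odd_double /= mul0r addr0 addn1 mul2n uphalf_double.
Qed.

(** * The sum of the inverse fourth powers of the odd numbers *)

Local Open Scope classical_set_scope.
Local Open Scope ring_scope.

Lemma sin_le_id (R : realType) (x : R) : 0 < x -> sin x <= x.
Proof.
move=> x0; have [c _] : exists2 c : R, c \in `]0, x[ & sin x - sin 0 = cos c * (x - 0).
  apply: (@MVT R sin cos 0 x x0).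
  by apply: continuous_subspaceT => y; exact: continuous_sin.
rewrite sin0 !subr0 => ->; rewrite -[leRHS]mul1r ler_wpM2r ?cos_le1 //; exact: ltW.
Qed.

(** This is [x <= tan x] without division: [sin t - t * cos t] has derivative [t * sin t],
    nonnegative on the interval. *)
Lemma id_cos_le_sin (R : realType) (x : R) : 0 < x < pi -> x * cos x <= sin x.
Proof.
move=> /andP[x0 xpi].
pose f (t : R) := sin t - t * cos t.
have der (y : R) : is_derive y 1 f (y * sin y).
  rewrite /f; apply: is_derive_eq; rewrite /GRing.scale /=; ring.
have [c] : exists2 c : R, c \in `]0, x[ & f x - f 0 = c * sin c * (x - 0).
  apply: (@MVT R f (fun t => t * sin t) 0 x x0).
  apply: continuous_subspaceT => y.
  by apply/differentiable_continuous/derivable1_diffP; apply: ex_derive.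
rewrite in_itv /= => /andP[c0 cx]; rewrite /f sin0 mul0r !subr0 => E.
rewrite -subr_ge0 E !mulr_ge0 ?ltW //.
by apply: sin_gt0_pi; rewrite c0 (lt_trans cx).
Qed.

Lemma sum_inv_sq_bound (R : realType) k :
  \sum_(0 <= j < k) (2 * j + 1)%:R ^- 2 <= 2 :> R.
Proof.
have H : \sum_(0 <= j < k) (2 * j + 1)%:R ^- 2 <= \sum_(1 <= j < k.+1) j%:R ^- 2 :> R.
  rewrite [leRHS]big_add1 /=; apply: ler_sum => j _.
  by rewrite lef_pV2 ?posrE ?exprn_gt0 ?ltr0n ?addn1 // lerXn2r ?nnegrE ?ler_nat // ltnS mul2n -addnn leq_addr.
apply: le_trans H _; case: k => [|k]; first by rewrite big_geq.
rewrite big_ltn // expr1n invr1 -[leRHS]/(1 + 1) lerD2l.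
by apply: le_trans (@sum_inv_sq_le R 1 k.+1 _) _; rewrite ?invr1.
Qed.

(** [limn] denotes the limit only once convergence is known; here it is absolute. *)
Lemma catalan_cvg (R : realType) :
  series (fun n : nat => (-1) ^+ n / (2 * n + 1)%:R ^+ 2 : R) @ \oo --> catalan R.
Proof.
apply: normed_cvg; apply: nondecreasing_is_cvgn.
  by apply: nondecreasing_series => n _ _; exact: normr_ge0.
exists 2 => _ [k _ <-]; rewrite /series /=; apply: le_trans (sum_inv_sq_bound R k).
apply: ler_sum => j _; rewrite normrM normrX normrN1 expr1n mul1r normfV.
by rewrite ger0_norm ?exprn_ge0.
Qed.

(** The step from [n] to [n + 1] adds [t = 1 / (n + 1)], while [ln] grows by [- ln (1 - t)], which
    is at least [t]. *)
Lemma harmonic_sum_le_ln (R : realType) (n : nat) : (0 < n)%N ->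
  harmonic_sum n <= 1 + ln n%:R :> R.
Proof.
rewrite /harmonic_sum; elim: n => // -[_ _|n IH _]; first by rewrite big_nat1 invr1 ln1 addr0.
rewrite big_nat_recr //=; apply: le_trans (lerD (IH isT) (lexx _)) _.
rewrite -addrA lerD2l -lerBrDl -ln_div ?posrE ?ltr0n //.
have -> : n.+2%:R / n.+1%:R = (1 - n.+2%:R^-1)^-1 :> R.
  rewrite -[n.+2%:R]natr1; have := ltr0Sn R n; move: n.+1%:R => a a0.
  have a1 : a + 1 != 0 by rewrite gt_eqF ?addr_gt0.
  have -> : 1 - (a + 1)^-1 = a / (a + 1) by field.
  by rewrite invf_div.
have h : 0 < 1 - n.+2%:R^-1 :> R.
  by rewrite subr_gt0 invf_lt1 ?ltr0n // ltr1n.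
rewrite lnV // lerNr.
apply: le_ln1Dx.
by rewrite ltrN2 invf_lt1 ?ltr0n // ltr1n.
Qed.

(** * Power sums of the squared cosecant over odd multiples of [pi / 2 ^ (n + 2)] *)

Definition node {R : realType} (n k : nat) : R := (2 * k + 1)%:R * pi / 2 ^+ n.+2.

Definition csc2 {R : realType} (x : R) : R := (sin x ^+ 2)^-1.

Lemma node_bounds (R : realType) (n k : nat) : (k < 2 ^ n)%N -> 0 < (node n k : R) < pi / 2.
Proof.
move=> kn; rewrite /node; apply/andP; split.
  by rewrite divr_gt0 ?exprn_gt0 // mulr_gt0 ?pi_gt0 // ltr0n addn1.
rewrite ltr_pdivrMr ?exprn_gt0 // exprS mulrA divfK ?pnatr_eq0 //.
rewrite mulrC ltr_pM2l ?pi_gt0 // -natrX ltr_nat expnS; lia.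
Qed.

Lemma node_half (R : realType) (n k : nat) : node n.+1 k = node n k / 2 :> R.
Proof. by rewrite /node exprS invfM; ring. Qed.

Lemma node_reflect (R : realType) (n k : nat) : (k < 2 ^ n)%N ->
  node n.+1 (2 ^ n.+1 - k.+1) = pi / 2 - node n k / 2 :> R.
Proof.
move=> kn; rewrite /node.
have -> : (2 * (2 ^ n.+1 - k.+1) + 1)%:R = 2 ^+ n.+2 - (2 * k + 1)%:R :> R.
  apply/(addIr (2 * k + 1)%:R); rewrite subrK -natrX -natrD; congr (_%:R).
  by rewrite !expnS; lia.
rewrite [2 ^+ n.+3]exprS; have := exprn_gt0 n.+2 (ltr0Sn R 1).
move: (2 ^+ n.+2) => a a0; field.
by rewrite gt_eqF.
Qed.

(** The lower half of the nodes of level [n + 1] are the halves of those of level [n]; the upper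
    half, in reverse order, are their complements to [pi / 2]. *)
Lemma sum_node_split (R : realType) (n : nat) (F : R -> R) :
  \sum_(k < 2 ^ n.+1) F (node n.+1 k) =
  \sum_(k < 2 ^ n) (F (node n k / 2) + F (pi / 2 - node n k / 2)).
Proof.
rewrite [in LHS]expnS mul2n -addnn big_split_ord /= big_split /=; congr (_ + _).
  by apply: eq_bigr => k _; rewrite node_half.
rewrite (reindex_inj rev_ord_inj) /=; apply: eq_bigr => k _.
rewrite -node_reflect //; congr (F (node _ _)).
by rewrite expnS; have := ltn_ord k; lia.
Qed.

(* With [h = x / 2], [1 / sin^2 h + 1 / cos^2 h] and [1 / (sin^2 h cos^2 h)]
   both equal [4 / sin^2 x]. *)
Lemma csc2_half (R : realType) (x : R) : 0 < x < pi / 2 ->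
  (csc2 (x / 2) + csc2 (pi / 2 - x / 2) = 4 * csc2 x) *
  (csc2 (x / 2) ^+ 2 + csc2 (pi / 2 - x / 2) ^+ 2 = 16 * csc2 x ^+ 2 - 8 * csc2 x).
Proof.
move=> /andP[x0 xpi]; have p0 := pi_gt0 R; rewrite /csc2.
have -> : sin (pi / 2 - x / 2) = cos (x / 2) by rewrite sinB sin_pihalf cos_pihalf mul1r mul0r subr0.
have s0 : sin (x / 2) != 0 by rewrite gt_eqF // sin_gt0_pihalf //; apply/andP; split; lra.
have c0 : cos (x / 2) != 0 by rewrite gt_eqF // cos_gt0_pihalf //; apply/andP; split; lra.
have -> : sin x = 2 * (cos (x / 2) * sin (x / 2)).
  by rewrite mulr_natl -sin_mulr2n; congr sin; field.
have := cos2Dsin2 (x / 2); move: (sin _) (cos _) s0 c0 => s c s0 c0 cs.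
have E : (s ^+ 2)^-1 + (c ^+ 2)^-1 = ((c * s) ^+ 2)^-1.
  have -> : (s ^+ 2)^-1 + (c ^+ 2)^-1 = (c ^+ 2 + s ^+ 2) / (c * s) ^+ 2 by field; rewrite s0 c0.
  by rewrite cs mul1r.
have F : (s ^+ 2)^-1 * (c ^+ 2)^-1 = ((c * s) ^+ 2)^-1 by field; rewrite s0 c0.
have G : ((2 * (c * s)) ^+ 2)^-1 = ((c * s) ^+ 2)^-1 / 4 by field; rewrite s0 c0.
rewrite G; move: E F; move: (s ^+ 2)^-1 (c ^+ 2)^-1 ((c * s) ^+ 2)^-1 => a b w E F.
split; first by rewrite E; field.
have -> : a ^+ 2 + b ^+ 2 = (a + b) ^+ 2 - 2 * (a * b) by ring.
by rewrite E F; field.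
Qed.

Lemma csc2_piquarter (R : realType) : csc2 (pi / 4 : R) = 2.
Proof.
have p0 := pi_gt0 R.
have c0 : cos (pi / 4 : R) != 0 by rewrite gt_eqF // cos_gt0_pihalf //; apply/andP; split; lra.
have E : sin (pi / 4) = cos (pi / 4) :> R.
  by have := tan_piquarter R; rewrite /tan => /(congr1 ( *%R^~ (cos (pi / 4)))); rewrite divfK // mul1r.
have := cos2Dsin2 (pi / 4 : R); rewrite /csc2 -E -mulr2n => h.
have -> : sin (pi / 4 : R) ^+ 2 = 2^-1 by move: h; move: (sin _ ^+ 2) => a; lra.
by rewrite invrK.
Qed.

(** The two sums [S1] and [S2] start at 2 and 4, from the single node [pi / 4], and pass to [4 * S1]
    and [16 * S2 - 8 * S1]. *)
Lemma sum_csc2_node (R : realType) (n : nat) :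
  (\sum_(k < 2 ^ n) csc2 (node n k) = 2 * 4 ^+ n :> R) *
  (\sum_(k < 2 ^ n) csc2 (node n k) ^+ 2 = 8 / 3 * 16 ^+ n + 4 / 3 * 4 ^+ n :> R).
Proof.
elim: n => [|n [IH1 IH2]].
  rewrite expn0 !big_ord1 !expr0 (_ : node 0 0 = pi / 4); last first.
    by rewrite /node muln0 add0n mul1r -natrX.
  by rewrite csc2_piquarter; split; field.
split.
  rewrite (sum_node_split _ _ csc2).
  under eq_bigr => k _ do rewrite (csc2_half _ _ (node_bounds _ _ _ (ltn_ord k))).1.
  by rewrite -mulr_sumr IH1 exprS; ring.
rewrite (sum_node_split _ _ (fun x => csc2 x ^+ 2)).
under eq_bigr => k _ do rewrite (csc2_half _ _ (node_bounds _ _ _ (ltn_ord k))).2.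
by rewrite sumrB -!mulr_sumr IH1 IH2 !exprS; field.
Qed.

Lemma csc2_bounds (R : realType) (x : R) : 0 < x < pi / 2 ->
  csc2 x ^+ 2 - 2 * csc2 x <= x ^- 4 <= csc2 x ^+ 2.
Proof.
move=> /andP[x0 xp]; have p0 := pi_gt0 R; rewrite /csc2.
have s0 : 0 < sin x by rewrite sin_gt0_pihalf // x0.
have c0 : 0 < cos x by rewrite cos_gt0_pihalf // xp andbT; lra.
have sx := sin_le_id _ _ x0.
have cx : x * cos x <= sin x by apply: id_cos_le_sin; rewrite x0 /=; lra.
have -> : x ^- 4 = (x ^+ 2)^-1 ^+ 2 by rewrite exprVn -exprM.
have s2 : 0 < sin x ^+ 2 by rewrite exprn_gt0.
have x2 : 0 < x ^+ 2 by rewrite exprn_gt0.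
have u1 : (x ^+ 2)^-1 <= (sin x ^+ 2)^-1.
  by rewrite lef_pV2 ?posrE // lerXn2r ?nnegrE ?(ltW s0) ?(ltW x0).
have u2 : (sin x ^+ 2)^-1 - 1 <= (x ^+ 2)^-1.
  have -> : (sin x ^+ 2)^-1 - 1 = cos x ^+ 2 / sin x ^+ 2.
    by rewrite cos2sin2 mulrBl mul1r divff ?gt_eqF.
  rewrite ler_pdivrMr // mulrC ler_pdivlMr // mulrC -exprMn.
  by rewrite lerXn2r ?nnegrE ?mulr_ge0 ?(ltW s0) ?(ltW x0) ?(ltW c0).
(* This makes [csc2 x - 1] nonnegative, so its bound by [1 / x ^ 2] can be squared;
   [(b - 1) ^ 2 >= b ^ 2 - 2 * b] then gives the lower estimate. *)
have u3 : 1 <= (sin x ^+ 2)^-1.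
  by rewrite -[leLHS]invr1 lef_pV2 ?posrE // -[leRHS](cos2Dsin2 x) lerDr exprn_ge0 // ltW.
move: (sin x ^+ 2)^-1 (x ^+ 2)^-1 u1 u2 u3 => a b ba ab a1.
apply/andP; split; nra.
Qed.

(** Scaling the sum of [node ^- 4] by [pi ^ 4 / (256 * 16 ^ n)] turns its main term [8 / 3 * 16 ^ n]
    into [pi ^ 4 / 96]. The remainder lies between [- 8 / 3 * 4 ^ n] and [4 / 3 * 4 ^ n]. *)
Lemma odd_zeta4_bound (R : realType) (n : nat) :
  `|odd_zeta4 (2 ^ n).*2 - pi ^+ 4 / 96| <= pi ^+ 4 / 96 / 4 ^+ n :> R.
Proof.
rewrite odd_zeta4_double; have p0 := pi_gt0 R.
have a0 : 0 < 4 ^+ n :> R by rewrite exprn_gt0.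
have zE : \sum_(j < 2 ^ n) (2 * j + 1)%:R ^- 4 =
    pi ^+ 4 / (256 * (4 ^+ n) ^+ 2) * \sum_(k < 2 ^ n) (node n k) ^- 4 :> R.
  rewrite mulr_sumr; apply: eq_bigr => k _; rewrite /node.
  have -> : 2 ^+ n.+2 = 4 * 2 ^+ n :> R by rewrite !exprS; ring.
  have -> : 4 ^+ n = 2 ^+ n * 2 ^+ n :> R by rewrite -exprMn; congr (_ ^+ _); ring.
  have b0 : 0 < 2 ^+ n :> R by rewrite exprn_gt0.
  have k0 : 0 < (2 * k + 1)%:R :> R by rewrite ltr0n addn1.
  move: (2 ^+ n) ((2 * k + 1)%:R) pi b0 k0 p0 => b t p b0 k0 p0.
  by field; rewrite !gt_eqF.
have up : \sum_(k < 2 ^ n) (node n k) ^- 4 <= 8 / 3 * 16 ^+ n + 4 / 3 * 4 ^+ n :> R.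
  rewrite -(sum_csc2_node R n).2; apply: ler_sum => k _.
  by have /andP[] := csc2_bounds _ _ (node_bounds R n k (ltn_ord k)).
have lo : 8 / 3 * 16 ^+ n + 4 / 3 * 4 ^+ n - 2 * (2 * 4 ^+ n) <= \sum_(k < 2 ^ n) (node n k) ^- 4 :> R.
  rewrite -(sum_csc2_node R n).2 -(sum_csc2_node R n).1 mulr_sumr -sumrB; apply: ler_sum => k _.
  by have /andP[] := csc2_bounds _ _ (node_bounds R n k (ltn_ord k)).
have q0 : 0 <= pi ^+ 4 :> R by rewrite exprn_ge0 // ltW.
rewrite zE; move: up lo; rewrite (_ : 16 ^+ n = (4 ^+ n) ^+ 2 :> R); last first.
  by rewrite -exprM mulnC exprM; congr (_ ^+ _); ring.
move: (\sum_(k < _) _) (4 ^+ n) a0 (pi ^+ 4) q0 => S a a0 q q0 up lo.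
have -> : q / (256 * a ^+ 2) * S - q / 96 = q / (256 * a ^+ 2) * (S - 8 / 3 * a ^+ 2).
  by field; rewrite gt_eqF.
have -> : q / 96 / a = q / (256 * a ^+ 2) * (8 / 3 * a) by field; rewrite gt_eqF.
rewrite normrM ger0_norm ?divr_ge0 ?mulr_ge0 ?exprn_ge0 ?(ltW a0) //.
apply: ler_wpM2l; first by rewrite divr_ge0 ?mulr_ge0 ?exprn_ge0 ?(ltW a0).
by rewrite ler_norml; apply/andP; split; lra.
Qed.

(** * Asymptotics *)

Lemma cvg_dist_geometric (R : realType) (u : R^nat) (l c : R) :
  (forall n, `|u n - l| <= c / 2 ^+ n) -> u @ \oo --> l.
Proof.
move=> ul.
have c0 : (fun n => c / 2 ^+ n) @ \oo --> (0 : R).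
  under eq_fun do rewrite -exprVn.
  by apply: (@cvg_geometric R c 2^-1); rewrite ger0_norm // invf_lt1 // ltr1n.
apply: (@squeeze_cvgr _ _ _ _ (fun n => l - c / 2 ^+ n) (fun n => l + c / 2 ^+ n)).
- by apply: nearW => n; rewrite -ler_distl.
- by rewrite -[X in _ --> X]subr0; apply: cvgB => //; exact: cvg_cst.
- by rewrite -[X in _ --> X]addr0; apply: cvgD => //; exact: cvg_cst.
Qed.

Lemma expn2_cvg : (fun n => 2 ^ n)%N @ \oo --> \oo.
Proof.
apply/cvgnyPge => A; near=> n.
apply: (@leq_trans n); last exact/ltnW/ltn_expl.
by near: n; exact: nbhs_infty_ge.
Unshelve. all: by end_near. Qed.

Definition sqfree_L2_limit (R : realType) : R := 96 * catalan R / pi ^+ 4.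

(** Convergence is shown along the indices [2 ^ (n + 1)], where [odd_zeta4] is estimated; this
    suffices to identify the limit. *)
Lemma sqfree_L2_cvg (R : realType) :
  (fun n => sqfree_L2 (2 ^ n).*2) @ \oo --> sqfree_L2_limit R.
Proof.
have q0 : 0 < pi ^+ 4 / 96 :> R by rewrite divr_gt0 ?exprn_gt0 ?pi_gt0.
have Z : (fun n => odd_zeta4 (2 ^ n).*2) @ \oo --> (pi ^+ 4 / 96 : R).
  apply: (@cvg_dist_geometric _ _ _ (pi ^+ 4 / 96)) => n.
  apply: le_trans (odd_zeta4_bound R n) _.
  by rewrite ler_pM2l // lef_pV2 ?posrE ?exprn_gt0 // lerXn2r ?nnegrE // ler_nat.
have C : (fun n => chi4_L2 (2 ^ n).*2) @ \oo --> catalan R.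
  under eq_fun do rewrite chi4_L2_double.
  exact: cvg_comp expn2_cvg (catalan_cvg R).
have E : (fun n => sqfree_L2 (2 ^ n).*2 * odd_zeta4 (2 ^ n).*2 - chi4_L2 (2 ^ n).*2 : R) @ \oo --> (0 : R).
  apply: (@cvg_dist_geometric _ _ _ 1) => n; rewrite subr0 mul1r.
  apply: le_trans (sqfree_L2_odd_zeta4 _ _ _) _; first by rewrite double_gt0 expn_gt0.
  by rewrite -natrX lef_pV2 ?posrE ?ltr0n ?double_gt0 ?expn_gt0 // ler_nat -addnn leq_addr.
have H : (fun n => (sqfree_L2 (2 ^ n).*2 * odd_zeta4 (2 ^ n).*2 - chi4_L2 (2 ^ n).*2
     + chi4_L2 (2 ^ n).*2) / odd_zeta4 (2 ^ n).*2 : R) @ \oo --> (0 + catalan R) / (pi ^+ 4 / 96).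
  apply: cvgM; first exact: cvgD.
  by apply: cvgV => //; rewrite gt_eqF.
have -> : sqfree_L2_limit R = (0 + catalan R) / (pi ^+ 4 / 96).
  by rewrite /sqfree_L2_limit add0r; move: pi (pi_gt0 R) => p p0; field; rewrite gt_eqF.
apply: cvg_trans H; apply: near_eq_cvg; near=> n.
(* Dividing by [odd_zeta4] is harmless: its first term is 1 and the others are nonnegative. *)
rewrite subrK mulfK // gt_eqF // odd_zeta4_double.
have : (0 < 2 ^ n)%N by rewrite expn_gt0.
case: (2 ^ n)%N => // k _; rewrite big_ord_recl /= muln0 add0n expr1n invr1.
by rewrite ltr_pwDl // sumr_ge0.
Unshelve. all: by end_near. Qed.

(** The bound of [sqfree_L2_dist], uniform in the larger index, passes to the limit along the
    subsequence. *)
Lemma sqfree_L2_limit_dist (R : realType) (m : nat) : (0 < m)%N ->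
  `|sqfree_L2 m - sqfree_L2_limit R| <= m%:R^-1.
Proof.
move=> m0; rewrite distrC.
have L : (fun n => `|sqfree_L2 (2 ^ n).*2 - sqfree_L2 m : R|) @ \oo -->
    `|sqfree_L2_limit R - sqfree_L2 m|.
  by apply: cvg_norm; apply: cvgB; [exact: sqfree_L2_cvg|exact: cvg_cst].
apply: (cvgr_to_le L).
near=> n; apply: sqfree_L2_dist; rewrite m0 /=.
apply: (@leq_trans n); first by near: n; exact: nbhs_infty_ge.
by apply: leq_trans (ltnW (ltn_expl n (isT : (1 < 2)%N))) _; rewrite -addnn leq_addr.
Unshelve. all: by end_near. Qed.

Lemma sqfree_weighted_sum_asymp (R : realType) (y : R) : 1 <= y ->
  `|sqfree_weighted_sum (Num.truncn y) - sqfree_L2_limit R * y ^+ 3 / 3|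
    <= y ^+ 2 * (2 + ln y).
Proof.
move=> y1; have y0 : 0 < y by apply: lt_le_trans y1.
have yt := truncn_itv (ltW y0); have n0 : (0 < Num.truncn y)%N by rewrite truncn_gt0.
apply: le_trans (sqfree_weighted_sum_bound _ _ _ _ yt) _.
move: yt n0; move: (Num.truncn y) => n /andP[ny yn] n0.
have n0' : 0 < n%:R :> R by rewrite ltr0n.
have h1 : harmonic_sum n <= 1 + ln y.
  by apply: le_trans (harmonic_sum_le_ln _ _ n0) _; rewrite lerD2l ler_ln ?posrE.
(* From [y < n + 1 <= 2 * n] follows [1 / n <= 2 / y]. *)
have h2 : `|sqfree_L2 n - sqfree_L2_limit R| <= 2 / y.
  apply: le_trans (sqfree_L2_limit_dist _ _ n0) _.
  rewrite ler_pdivlMr // mulrC ler_pdivrMr //; apply: le_trans (ltW yn) _.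
  by rewrite -natrM ler_nat mul2n -addnn -addn1 leq_add2l.
have : y ^+ 3 / 3 * `|sqfree_L2 n - sqfree_L2_limit R| <= y ^+ 2 * (2 / 3).
  have -> : y ^+ 2 * (2 / 3) = y ^+ 3 / 3 * (2 / y) by field; rewrite gt_eqF.
  by rewrite ler_pM2l // divr_gt0 // exprn_gt0.
have : y ^+ 2 * harmonic_sum n <= y ^+ 2 * (1 + ln y) by rewrite ler_pM2l // exprn_gt0.
have : 0 <= y ^+ 2 by rewrite exprn_ge0 // ltW.
rewrite !mulrDr; lra.
Qed.

Lemma truncn_div4 (R : realType) (x : R) : 0 <= x ->
  Num.truncn (x / 4) = (Num.truncn x %/ 4)%N.
Proof.
move=> x0; have /andP[nx xn] := truncn_itv x0; apply: truncn_def.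
rewrite ler_pdivlMr // ltr_pdivrMr // -!natrM; apply/andP; split.
  by apply: le_trans nx; rewrite ler_nat leq_divM.
by apply: lt_le_trans xn _; rewrite ler_nat ltn_ceil.
Qed.

(** The main terms at [x] and [x / 4] combine to [(1 + 8 / 64) / 3 = 3 / 8] of the limit, and
    [96 * 3 / 8 = 36]. The errors combine with the factor [1 + 8 / 16 = 3 / 2]; [4 <= x] gives
    [1 <= x / 4]. *)
Lemma sum_N3_asymp (R : realType) (x : R) : 4 <= x ->
  `|\sum_(1 <= r < (Num.truncn x).+1) (N3 1 r)%:R - 36 * catalan R / pi ^+ 4 * x ^+ 3|
    <= x ^+ 2 * (3 + 3 / 2 * ln x).
Proof.
move=> x4; have x0 : 0 < x by apply: lt_le_trans x4.
have T1 : 1 <= x by lra.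
have T4 : 1 <= x / 4 by lra.
rewrite sum_N3 -truncn_div4 ?(ltW x0) //.
have := sqfree_weighted_sum_asymp _ _ T1; have := sqfree_weighted_sum_asymp _ _ T4.
have -> : 36 * catalan R / pi ^+ 4 * x ^+ 3 =
    sqfree_L2_limit R * x ^+ 3 / 3 + 8 * (sqfree_L2_limit R * (x / 4) ^+ 3 / 3).
  by rewrite /sqfree_L2_limit; move: pi (pi_gt0 R) => p p0; field; rewrite gt_eqF.
have lx : ln (x / 4) <= ln x by rewrite ler_ln ?posrE //; lra.
have : (x / 4) ^+ 2 * (2 + ln (x / 4)) <= (x / 4) ^+ 2 * (2 + ln x).
  by rewrite ler_wpM2l ?exprn_ge0 // ?lerD2l //; lra.
have -> : (x / 4) ^+ 2 * (2 + ln x) = x ^+ 2 * (2 + ln x) / 16 by field.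
rewrite !ler_norml => h /andP[a1 a2] /andP[b1 b2].
have -> : x ^+ 2 * (3 + 3 / 2 * ln x) = x ^+ 2 * (2 + ln x) * (3 / 2) by field.
by apply/andP; split; lra.
Qed.

Theorem proposition40 (R : realType) :
  (fun x : R => \sum_(1 <= r < (Num.truncn x).+1) (N3 1 r)%:R : R)
  = (fun x : R => 36 * catalan R / pi ^+ 4 * x ^+ 3)
    +O_ +oo (fun x : R => x ^+ 2 * ln x).
Proof.
(* Once [ln x >= 1], [3 + 3 / 2 * ln x] is at most [9 / 2 * ln x]. *)
apply/eqaddOP/bigO_exP; exists (9 / 2) => //.
near=> x.
have x4 : 4 <= x by near: x; apply: nbhs_pinfty_ge; exact: num_real.
have xe : expR 1 <= x by near: x; apply: nbhs_pinfty_ge; exact: num_real.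
have x0 : 0 < x by apply: lt_le_trans x4.
have l1 : 1 <= ln x by rewrite -[leLHS](expRK 1) ler_ln ?posrE ?expR_gt0.
apply: le_trans (sum_N3_asymp _ _ x4) _.
rewrite ger0_norm ?mulr_ge0 ?exprn_ge0 ?(ltW x0) //; last by apply: le_trans l1.
rewrite mulrCA ler_pM2l ?exprn_gt0 //; lra.
Unshelve. all: by end_near. Qed.
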